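(* Let $m\ge 2$ be an integer. Assume that, for every $1\le i\le m$, the sequence of functions $\{\phi_{m,n}^{i}\}_{n\ge1}$ converges uniformly on $[0,1]$ to a function $y_i$ which is continuous and differentiable on $(0,1]$. Then $y_i(1)=1$ for every $1\le i\le m-1$, $y_m(1)=0$, and the functions $y_1,\dots,y_m$ satisfy on $(0,1]$ the system of ODEs $$\begin{cases} (m-mx)\,y_1'(x)=(m-1)y_1(x)-(m-1)y_2(x) & (\text{if } m\ge3),\\ (mx-mx^2)\,y_i'(x)=m(x-1)y_1(x)+(m-ix)y_i(x)-x(m-i)y_{i+1}(x), & 2\le i\le m-2,\\ (mx-mx^2)\,y_{m-1}'(x)=-(m-mx)y_1(x)+(m-(m-1)x)y_{m-1}(x)-x^2,\\ x\,y_m'(x)=-y_1(x)+y_m(x). \end{cases}$$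
   Context: Multi-returning secretary problem: there are $n$ candidates with a strict total ranking, and each candidate has $m$ identical copies, so there are $mn$ objects. The objects are inspected one by one in uniformly random order (all $(mn)!$ orders equally likely). When an object is inspected we learn which already inspected candidate it is a copy of (if any) and how its candidate ranks relative to all candidates inspected so far, and we must immediately accept it (the process ends) or reject it irrevocably. Success means accepting a copy of the best of the $n$ candidates. At any moment the maximal candidate is the best among the candidates inspected so far. An inspected object is a nice candidate if it is the $m$-th (last) copy to appear of the candidate that is maximal at that moment. The process is in state $(k,i)$ if all objects inspected so far have been rejected, exactly $k$ different candidates have been inspected, and exactly $i$ copies of the maximal candidate among them have been inspected. For $1\le k\le n$ and $1\le i\le m$, $\Phi_{m,n}^{i}(k)$ is the probability of success when, starting from state $(k,i)$, one accepts the first nice candidate inspected from then on. For $x\in[0,1]$, $\phi_{m,n}^{i}(x):=\Phi_{m,n}^{i}(\lfloor xn\rfloor)$, with the convention $\Phi_{m,n}^{i}(0):=\Phi_{m,n}^{i}(1)$. Derivatives at $x=1$ are one-sided. *)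

(* Defs.v *)
From HB Require Import structures.
From mathcomp Require Import all_boot all_order all_algebra.
From mathcomp Require Import all_classical all_reals all_analysis.

Set Implicit Arguments.
Unset Strict Implicit.
Unset Printing Implicit Defensive.

Import Order.TTheory GRing.Theory Num.Theory.
Import numFieldNormedType.Exports.

Local Open Scope classical_set_scope.
Local Open Scope ring_scope.

(* Multi-returning secretary problem with n candidates and m copies of each.  *)
(* Candidates are the elements of 'I_n, a larger number meaning a better      *)
(* rank; the object (c, j) is the j-th copy of candidate c.  The label j only *)
(* makes the m * n objects distinct and is never observed.                    *)
Definition object (n m : nat) : Type := ('I_n * 'I_m)%type.

(* The sample space: a duplicate-free list of the (m * n)! inspection orders. *)
Definition orders (n m : nat) : seq (seq (object n m)) :=
  permutations (enum {: 'I_n * 'I_m}).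

Section Inspection.
Variables n m : nat.
Implicit Types (h s : seq (object n m)) (o : object n m) (c : 'I_n).

(* In what follows h is a history, i.e., the list of the objects inspected so *)
(* far in chronological order.                                                *)

Definition ncandidates h : nat := size (undup (unzip1 h)).

(* Meaningful when a copy of c occurs in h. *)
Definition maximal h c : bool := all (fun o => (o.1 <= c)%N) h.

Definition state h : nat * nat :=
  (ncandidates h, count (fun o => maximal h o.1) h).

(* o, inspected right after the history h, is a nice candidate. *)
Definition nice h o : bool :=
  let h' := rcons h o in
  maximal h' o.1 && (count_mem o.1 (unzip1 h') == m).

(* The object accepted by the rule "accept the first nice candidate", when    *)
(* all the objects of h have been rejected and those of s are yet to come.    *)
Fixpoint accepted h s : option (object n m) :=
  if s is o :: s' then
    if nice h o then Some o else accepted (rcons h o) s'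
  else None.

Definition best c : bool := [forall d : 'I_n, (d <= c)%N].

(* The process visits the state ki when objects are inspected in the order s. *)
Definition visits (ki : nat * nat) s : bool :=
  has (fun t => state (take t s) == ki) (iota 0 (size s).+1).

(* The number of objects inspected when the process enters the state ki.  No  *)
(* nice candidate is inspected while the state stays equal to ki, hence       *)
(* starting the rule at a later time spent in ki would not change its result. *)
Definition entry (ki : nat * nat) s : nat :=
  find (fun t => state (take t s) == ki) (iota 0 (size s).+1).

Definition success (ki : nat * nat) s : bool :=
  let t := entry ki s in
  if accepted (take t s) (drop t s) is Some o then best o.1 else false.

End Inspection.

(* Conditional probability, under the uniform distribution on the inspection  *)
(* orders and given that the process visits the state (k, i), that the rule   *)
(* "accept the first nice candidate", applied from that state on, succeeds.   *)
Definition Phi (R : realType) (m n i k : nat) : R :=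
  (count (fun s => visits (k, i) s && success (k, i) s) (orders n m))%:R /
  (count (visits (k, i)) (orders n m))%:R.

(* Num.truncn is the floor on nonnegative reals; the maximum implements the   *)
(* convention Phi m n i 0 := Phi m n i 1.                                     *)
Definition phi (R : realType) (m n i : nat) (x : R) : R :=
  Phi R m n i (maxn 1 (Num.truncn (x * n%:R))).

(* Derivative relative to a set D: two-sided at the interior points of D and  *)
(* one-sided at the end points of an interval.                                *)
Definition diff_quotient (R : realType) (f : R -> R) (x z : R) : R :=
  (f z - f x) / (z - x).

Definition derivable_within (R : realType) (D : set R) (f : R -> R) (x : R) :=
  cvg (diff_quotient f x z @[z --> within D x^']).

Definition derive_within (R : realType) (D : set R) (f : R -> R) (x : R) : R :=
  lim (diff_quotient f x z @[z --> within D x^']).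

(* Main.v *)
Require Import Defs.
From HB Require Import structures.
From mathcomp Require Import all_boot all_order all_algebra.
From mathcomp Require Import all_classical all_reals all_analysis.
From mathcomp Require Import fingroup perm zify ring lra.
Import Order.TTheory GRing.Theory Num.Theory.
Import numFieldNormedType.Exports.
Set Implicit Arguments.
Unset Strict Implicit.
Unset Printing Implicit Defensive.
Local Open Scope ring_scope.

(* From state (k, i) only the m - i remaining copies of the maximal candidate *)
(* and the m (n - k) copies of the unseen candidates matter, so the next      *)
(* relevant object leads to (k, i + 1) with probability                       *)
(* (m - i) / (m - i + m (n - k)) and is a new candidate otherwise, which is   *)
(* maximal with probability 1 / (k + 1).  This yields a recurrence expressing *)
(* Phi^i(k) by Phi^(i+1)(k), Phi^1(k+1) and Phi^i(k+1), with Phi^(i+1)(k)     *)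
(* replaced by k / n when i = m - 1.  As absolute ranks are not independent   *)
(* of the history, the success probability is first computed given the set K  *)
(* of the seen candidates (win), and then averaged over the k-subsets K, all  *)
(* equally likely by order-preserving relabellings.                           *)
(* The recurrence says that n (Phi^i(k+1) - Phi^i(k)) is a continuous         *)
(* function of k / n, Phi^i(k), Phi^1(k+1) and Phi^(i+1)(k), up to O(1 / n);  *)
(* summing it over the k with k / n between two points near x and letting n   *)
(* tend to infinity gives the derivative of y_i at x.                         *)

(** * Success probability given the seen candidates *)

(** The function [win u j K] is the success probability when K is the set of seen candidates, u
    candidates are unseen and j copies of the best of K are still to come; [winE] is its first-step
    equation. By induction on the uninspected objects, [sum_accepted] shows that [value h], an
    instance of [win], is the proportion of continuations of h on which the rule succeeds.
    Reshuffling the objects that follow the entry time ([count_success]) and the equidistribution of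
    the seen set ([count_enters]) turn [Phi] into the mean of [win] over the k-subsets ([Phi_win]),
    and averaging [winE] gives the recurrence [Phi_rec]. Put r = k / n, and let q be k / n if i = m
    - 1 and Phi^(i+1)(k) otherwise. Solved for the increment, the recurrence reads n (Phi^i(k+1) -
    Phi^i(k)) = (Phi^i(k) - Phi^1(k+1)) / r + ((m - i) / m) (1 + 1 / k) (Phi^i(k) - q) / (1 - r).
    Uniform convergence and continuity give the limit of the right-hand side as k / n tends to x
    ([cvg_Phi_shift]), and telescoping identifies it with the derivative of y_i
    ([derive_within_ratio], [derive_limit]). The boundary values come from [Phi_last]. *)

Section Permutations.
Variables (T : eqType) (V : nmodType).
Implicit Types (r : seq T).

Lemma sum_permutations_cons (f : seq T -> V) r : uniq r -> (0 < size r)%N ->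
  \sum_(s <- permutations r) f s =
  \sum_(x <- r) \sum_(s <- permutations (rem x r)) f (x :: s).
Proof.
move=> ur r0; rewrite (perm_big _ (permutationsE r0)) undup_id//.
by rewrite big_allpairs_dep.
Qed.

(** Once the first t entries of a permutation are fixed, the others occur in every order equally
    often, so the tail may be reshuffled independently; the factorial counts the reshufflings. This
    is how the proof conditions on a history at a fixed time. *)
Lemma sum_permutations_drop t (f : seq T -> seq T -> V) r :
  uniq r -> (t <= size r)%N ->
  (\sum_(s <- permutations r) f (take t s) (drop t s)) *+ (size r - t)`! =
  \sum_(s <- permutations r) \sum_(s' <- permutations (drop t s)) f (take t s) s'.
Proof.
elim: t f r => [|t IH] f r ur tr.
  rewrite subn0.
  transitivity (\sum_(s <- permutations r) \sum_(s' <- permutations r) f [::] s').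
    rewrite big_const_seq count_predT size_permutations// iter_addr_0.
    by congr (_ *+ _); apply: eq_bigr => s _; rewrite take0 drop0.
  rewrite big_seq [RHS]big_seq; apply: eq_bigr => s.
  rewrite mem_permutations take0 drop0 => /perm_permutations sr.
  by rewrite (perm_big _ sr).
have r0 : (0 < size r)%N by lia.
rewrite !sum_permutations_cons// -sumrMnl.
rewrite big_seq [RHS]big_seq; apply: eq_bigr => x xr.
have sz := size_rem xr.
have := IH (fun a b => f (x :: a) b) (rem x r) (rem_uniq _ ur).
by rewrite sz => <-; [congr (_ *+ _`!); lia|lia].
Qed.

End Permutations.

(** * Value of a history and its one-step equation *)

Section Value.
Variables (R : realType) (n m : nat).
Implicit Types (h s r : seq (object n m)) (o : object n m) (c : 'I_n) (K : {set 'I_n}).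

Definition seen h : {set 'I_n} := [set c in unzip1 h].

Definition above K c : bool := [forall d in K, (d <= c)%N].

Definition has_best K : bool := [exists c in K, best c].

(* Meaningful when u = n - #|K|: K is the set of the seen candidates, and j   *)
(* copies of the best of them are still to come.                              *)
Fixpoint win (u : nat) : nat -> {set 'I_n} -> R :=
  fix win_u (j : nat) (K : {set 'I_n}) : R :=
    ((if j is j'.+1 then
        j%:R * (if j' is 0%N then (has_best K)%:R else win_u j' K) else 0) +
     (if u is u'.+1 then
        m%:R * \sum_(c | c \notin K)
                 win u' (if above K c then m.-1 else j) (c |: K) else 0)) /
    (j + m * u)%:R.

Lemma winE K j u : (0 < m)%N -> u = #|~: K| ->
  (j + m * u)%:R * win u j K =
  j%:R * (if j == 1%N then (has_best K)%:R else win u j.-1 K) +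
  m%:R * \sum_(c | c \notin K)
           win u.-1 (if above K c then m.-1 else j) (c |: K).
Proof.
move=> m0 uK.
have K0 : u = 0%N -> \sum_(c | c \notin K)
    win u.-1 (if above K c then m.-1 else j) (c |: K) = 0.
  move=> u0; apply: big1 => c; rewrite -finset.in_setC.
  by have /eqP := esym uK; rewrite u0 cards_eq0 => /eqP ->; rewrite inE.
(* As m > 0, a zero denominator means j = u = 0, and both sides of the equation are then 0. *)
case: (eqVneq (j + m * u)%N 0%N) => [/eqP|ju0].
  rewrite addn_eq0 muln_eq0 => /andP[/eqP j0 /orP[/eqP m0'|/eqP u0]].
    by rewrite m0' in m0.
  by rewrite K0// j0 u0 !muln0 !mul0r mulr0 addr0.
have -> : win u j K = ((if j is j'.+1 then
        j%:R * (if j' is 0%N then (has_best K)%:R else win u j' K) else 0) +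
     (if u is u'.+1 then
        m%:R * \sum_(c | c \notin K)
                 win u' (if above K c then m.-1 else j) (c |: K) else 0)) /
    (j + m * u)%:R.
  by case: (u); case: (j).
rewrite mulrC divfK ?pnatr_eq0//; congr (_ + _).
  by case: (j) => [|[|j']]; rewrite ?mul0r.
by case: (u) K0 => [->|u' _] //; rewrite mulr0.
Qed.

Definition value h : R := win #|~: seen h| (m - (state h).2) (seen h).

Lemma seen_rcons h o : seen (rcons h o) = o.1 |: seen h.
Proof. by apply/setP => c; rewrite !inE /unzip1 map_rcons mem_rcons inE. Qed.

Lemma ncandidatesE h : ncandidates h = #|seen h|.
Proof.
rewrite /ncandidates -(card_uniqP (undup_uniq _)).
by apply: eq_card => c; rewrite mem_undup inE.
Qed.

Lemma maximalP h c : reflect (forall d, d \in seen h -> (d <= c)%N) (maximal h c).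
Proof.
apply: (iffP allP) => H.
  by move=> d; rewrite inE => /mapP[x xh ->]; apply: H.
by move=> o oh; apply: H; rewrite inE map_f.
Qed.

Lemma aboveE h c : above (seen h) c = maximal h c.
Proof.
apply/forallP/maximalP => H d; first by apply/implyP.
by apply/implyP; exact: H.
Qed.

Lemma exists_top h : h != [::] -> exists2 c, c \in seen h & maximal h c.
Proof.
case: h => [//|o h] _; set h' := o :: h.
have oh : o.1 \in seen h' by rewrite !inE eqxx.
case: (@arg_maxnP _ o.1 (fun c => c \in seen h') (fun c => c : nat) oh) => c ch cmax.
by exists c => //; apply/maximalP.
Qed.

Lemma maximal_in_seen h c d : c \in seen h -> maximal h c -> d \in seen h ->
  maximal h d = (d == c).
Proof.
move=> ch /maximalP cm dh; apply/maximalP/eqP => [dm|-> //].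
by apply/val_inj/eqP; rewrite eqn_leq cm ?dm.
Qed.

Lemma state_top h c : c \in seen h -> maximal h c ->
  (state h).2 = count_mem c (unzip1 h).
Proof.
move=> ch cm; rewrite /state /= count_map; apply: eq_in_count => o oh /=.
by apply: maximal_in_seen => //; rewrite inE map_f.
Qed.

Definition remaining h c : nat :=
  #|[pred o : object n m | (o \notin h) && (o.1 == c)]|.

Lemma remainingE h c : uniq h -> remaining h c = (m - count_mem c (unzip1 h))%N.
Proof.
move=> uh.
have cm : #|[pred o : 'I_n * 'I_m | o.1 == c]| = m.
  rewrite -[RHS]card_ord -[RHS]mul1n -(card1 c).
  rewrite -[#|'I_m|]cardsT -[X in (X * _)%N]cardsE -cardsX -[LHS]cardsE.
  by apply: eq_card => -[a b]; rewrite !inE /= andbT.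
rewrite -[X in (X - _)%N]cm.
rewrite -(cardID [pred o | o \in h] [pred o : 'I_n * 'I_m | o.1 == c]).
have -> : #|[predI [pred o : 'I_n * 'I_m | o.1 == c] & [pred o | o \in h]]| =
    count_mem c (unzip1 h).
  rewrite count_map -size_filter -(card_uniqP (filter_uniq _ uh)).
  by apply: eq_card => o; rewrite !inE mem_filter.
by rewrite addKn; apply: eq_card => o; rewrite !inE.
Qed.

Lemma has_bestE h c : c \in seen h -> maximal h c -> has_best (seen h) = best c.
Proof.
move=> ch /maximalP cm; apply/existsP/idP => [[d /andP[dh db]]|cb]; last first.
  by exists c; rewrite ch.
apply/forallP => e; have /forallP/(_ e) := db.
by move=> /leq_trans; apply; exact: cm.
Qed.

Lemma maximal_rcons h o c : maximal (rcons h o) c = maximal h c && (o.1 <= c)%N.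
Proof. by rewrite /maximal all_rcons andbC. Qed.

Lemma count_rcons h o c :
  count_mem c (unzip1 (rcons h o)) = (count_mem c (unzip1 h) + (o.1 == c))%N.
Proof. by rewrite /unzip1 map_rcons -cats1 count_cat /= addn0. Qed.

(** Success probability once o has been inspected after h: acceptance settles the outcome, rejection
    continues from the longer history. *)
Definition after h o : R :=
  if nice h o then (best o.1)%:R else value (rcons h o).

Lemma notin_seen_count h c : c \notin seen h -> count_mem c (unzip1 h) = 0%N.
Proof. by move=> ch; apply/count_memPn; move: ch; rewrite inE. Qed.

Lemma after_top h o : o.1 \in seen h -> maximal h o.1 -> 
  ((state h).2 < m)%N ->
  after h o = (if (m - (state h).2)%N == 1%N then (has_best (seen h))%:R
               else win #|~: seen h| (m - (state h).2).-1 (seen h)).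
Proof.
move=> oh om im; have sE := state_top oh om.
have mh' : maximal (rcons h o) o.1 by rewrite maximal_rcons om leqnn.
have sh' : seen (rcons h o) = seen h.
  by rewrite seen_rcons; apply/finset.setUidPr; rewrite finset.sub1set.
have sE' : (state (rcons h o)).2 = (state h).2.+1.
  by rewrite (state_top _ mh') ?sh'// count_rcons eqxx addn1 sE.
rewrite /after /nice /= mh' /= count_rcons eqxx -sE (has_bestE oh om).
have -> : ((state h).2 + true == m) = ((m - (state h).2)%N == 1%N) by lia.
by case: ifP => // _; rewrite /value sh' sE' subnS.
Qed.

Lemma after_seen h o : o.1 \in seen h -> ~~ maximal h o.1 ->
  after h o = value h.
Proof.
move=> oh om.
have sh' : seen (rcons h o) = seen h.
  by rewrite seen_rcons; apply/finset.setUidPr; rewrite finset.sub1set.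
have hn : h != [::] by apply: contraNneq om => ->.
have [c ch cm] := exists_top hn.
rewrite /after /nice /= maximal_rcons (negbTE om) /=.
have oc : (o.1 <= c)%N by move/maximalP: cm; apply.
have cm' : maximal (rcons h o) c by rewrite maximal_rcons cm.
rewrite /value sh' (state_top ch cm) (state_top _ cm') ?sh'//.
rewrite count_rcons (_ : (o.1 == c) = false) ?addn0//.
by apply/negbTE; apply: contraNneq om => ->.
Qed.

(** Since m > 1, the first copy of a candidate is never nice. If it is maximal, m - 1 of its copies
    remain; otherwise the count for the old maximum is unchanged. *)
Lemma after_new h o : (1 < m)%N -> h != [::] -> o.1 \notin seen h ->
  after h o = win #|~: seen h|.-1
    (if above (seen h) o.1 then m.-1 else (m - (state h).2)%N) (o.1 |: seen h).
Proof.
move=> m1 hn oh.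
have -> : #|~: seen h|.-1 = #|~: seen (rcons h o)|.
  rewrite seen_rcons finset.setCU (finset.setIC (~: _)) -finset.setDE.
  by rewrite (cardsD1 o.1 (~: seen h)) inE oh.
rewrite aboveE /after /nice /= maximal_rcons leqnn andbT /value.
rewrite count_rcons (notin_seen_count oh) eqxx.
have -> : (0 + true == m)%N = false by lia.
rewrite andbF.
rewrite seen_rcons; case: ifP => om.
  have om' : maximal (rcons h o) o.1 by rewrite maximal_rcons om leqnn.
  rewrite (state_top _ om') ?seen_rcons ?finset.setU11// count_rcons eqxx.
  by rewrite notin_seen_count// subn1.
have [c ch cm] := exists_top hn.
have oc : (o.1 <= c)%N.
  rewrite leqNgt; apply: contraFN om => co; apply/maximalP => d dh.
  by move/maximalP: cm => /(_ _ dh) dc; rewrite (leq_trans dc)// ltnW.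
have cm' : maximal (rcons h o) c by rewrite maximal_rcons cm.
rewrite (state_top _ cm') ?seen_rcons ?finset.setU1r//.
rewrite count_rcons -(state_top ch cm) (_ : (o.1 == c) = false) ?addn0//.
by apply/negbTE; apply: contraNneq oh => ->.
Qed.

(* A further copy of a seen, non-maximal candidate leaves the value unchanged, *)
(* so only the terms of winE contribute.                                       *)
Lemma sum_after h : (1 < m)%N -> h != [::] -> uniq h ->
  \sum_(o | o \notin h) after h o = #|[pred o | o \notin h]|%:R * value h.
Proof.
move=> m1 hn uh.
have [M Mh Mm] := exists_top hn.
suff: \sum_(o | o \notin h) (after h o - value h) = 0.
  rewrite big_split /= sumrN => /eqP; rewrite addr_eq0 opprK => /eqP ->.
  by rewrite sumr_const mulr_natl.
set u := #|~: seen h|; set j := (m - (state h).2)%N.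
(* [after h o] depends only on the candidate of o, so the sum can be grouped by candidate: M
   contributes j objects, each unseen candidate m objects, and the differences for the other seen
   candidates vanish. *)
pose f c : R := if c \in seen h then
    if c == M then
      (if j == 1%N then (has_best (seen h))%:R else win u j.-1 (seen h))
    else value h
  else win u.-1 (if above (seen h) c then m.-1 else j) (c |: seen h).
have rM : remaining h M = j by rewrite remainingE// /j (state_top Mh Mm).
have fE o : o \notin h -> after h o = f o.1.
  move=> oh; rewrite /f; case: ifP => os; last by apply: after_new; rewrite ?os.
  case: eqP => [oM|/eqP oM]; last first.
    by apply: after_seen => //; rewrite (maximal_in_seen Mh Mm).
  rewrite after_top ?oM//.
  rewrite -subn_gt0 -/j -rM; apply/card_gt0P; exists o.
  by rewrite !inE oh oM eqxx.
rewrite (eq_bigr (fun o => f o.1 - value h)); last by move=> o oh; rewrite fE.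
rewrite (partition_big (fun o : object n m => o.1) predT) //=.
have inner c : \sum_(o : object n m | (o \notin h) && (o.1 == c)) (f o.1 - value h) =
    (remaining h c)%:R * (f c - value h).
  under eq_bigr => o /andP[_ /eqP ->] do over.
  by rewrite sumr_const mulr_natl.
under eq_bigr do rewrite inner.
rewrite (bigID (fun c => c \in seen h)) /= (bigD1 M)//= big1 ?addr0; last first.
  by move=> c /andP[ch /negbTE cM]; rewrite /f ch cM subrr mulr0.
under eq_bigr => c ch do
  rewrite remainingE// (notin_seen_count ch) subn0.
rewrite -mulr_sumr big_split /= sumrN sumr_const rM {1}/f Mh eqxx.
have /(@winE (seen h) j u) : (0 < m)%N by exact: ltnW.
move=> /(_ erefl); rewrite natrD natrM -/(value h) => E.
have -> : \sum_(c | c \notin seen h) f c =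
    \sum_(c | c \notin seen h)
      win u.-1 (if above (seen h) c then m.-1 else j) (c |: seen h).
  by apply: eq_bigr => c /negbTE ch; rewrite /f ch.
have -> : #|[pred c | c \notin seen h]| = u by apply: eq_card => c; rewrite !inE.
rewrite /value -/u -/j in E *.
rewrite !mulrBr addrACA -E -mulr_natr.
by ring.
Qed.

(** Induction on the number of uninspected objects: the induction hypothesis evaluates the
    continuations that begin with a given o as [after h o], and [sum_after] says that these average
    to [value h]. *)
Lemma sum_accepted r h : (1 < m)%N -> h != [::] ->
  perm_eq (h ++ r) (enum {: 'I_n * 'I_m}) ->
  \sum_(s <- permutations r)
    (if accepted h s is Some o then best o.1 else false)%:R =
  (size r)`!%:R * value h.
Proof.
move=> m1; have [k] := ubnP (size r); elim: k r h => // k IH r h rk hn hr.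
have uhr : uniq (h ++ r) by rewrite (perm_uniq hr) enum_uniq.
have [uh hdr ur] := and3P (etrans (esym (cat_uniq _ _)) uhr).
have hC o : (o \notin h) = (o \in r).
  have := perm_mem hr o; rewrite mem_cat mem_enum inE.
  case oh: (o \in h) => /= or; last by rewrite or.
  by apply/esym/negbTE; apply: contra hdr => or'; apply/hasP; exists o.
have sumr (g : object n m -> R) : \sum_(o <- r) g o = \sum_(o | o \notin h) g o.
  by rewrite big_uniq//=; apply: eq_bigl => o; rewrite hC.
have cardr : #|[pred o | o \notin h]| = size r.
  by rewrite -(card_uniqP ur); apply: eq_card => o; rewrite inE hC.
(* With nothing left to inspect, no object is accepted, and j = u = 0 makes [value h] equal to 0. *)
have [r0|r0] := posnP (size r).
  have := sum_after m1 hn uh; rewrite -sumr cardr.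
  move/size0nil: r0 => r0; rewrite r0 in hr *.
  rewrite /permutations /= big_seq1 /= => _.
  have hfull o : o \in h by have := perm_mem hr o; rewrite cats0 mem_enum inE.
  have [M Mh Mm] := exists_top hn.
  have sT : #|~: seen h| = 0%N.
    apply: eq_card0 => c; rewrite !inE; apply/negbF.
    by apply/mapP; exists (c, Ordinal (ltnW m1)).
  have jE : (m - (state h).2)%N = 0%N.
    rewrite (state_top Mh Mm) -remainingE//.
    by apply: eq_card0 => o; rewrite !inE hfull.
  by rewrite /value jE sT /= add0r mul0r mulr0.
rewrite sum_permutations_cons//.
transitivity (\sum_(o <- r) (size r).-1`!%:R * after h o).
  rewrite big_seq [RHS]big_seq; apply: eq_bigr => o or /=.
  have sz := size_rem or.
  rewrite /after; case: ifP => _.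
    rewrite big_const_seq count_predT size_permutations ?rem_uniq//.
    by rewrite iter_addr_0 sz mulr_natl.
  rewrite IH ?sz//.
  - rewrite -ltnS prednK //.
  - by case: (h).
  by rewrite -cats1 -catA -(permPr hr) perm_cat2l perm_sym; exact: perm_to_rem.
rewrite -mulr_sumr sumr sum_after// cardr.
rewrite mulrA -natrM; congr (_%:R * _).
by rewrite mulnC; case: (size r) r0.
Qed.
End Value.

(** * Equidistribution of the seen candidates *)

(** List each set in increasing order, followed by its complement, and match equal positions in the
    two lists. Monotonicity is obtained on K only. *)
Lemma monotone_perm n (K K' : {set 'I_n}) : #|K| = #|K'| ->
  exists p : {perm 'I_n}, p @: K = K' /\
    {in K &, forall a b, (p a <= p b)%N = (a <= b)%N}.
Proof.
move=> KK'; pose e (A : {set 'I_n}) := enum A ++ enum (~: A).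
have size_e A : size (e A) = n by rewrite size_cat -!cardE cardsC card_ord.
have uniq_e A : uniq (e A).
  rewrite cat_uniq !enum_uniq andbT /=; apply/hasPn => a.
  by rewrite !mem_enum inE.
have mem_e A a : a \in e A by rewrite mem_cat !mem_enum inE orbN.
have sorted_e (A : {set 'I_n}) : sorted (fun a b : 'I_n => (a < b)%N) (enum A).
  rewrite {1}/enum_mem; apply: sorted_filter; first by move=> ? ? ?; apply: ltn_trans.
  by have := iota_ltn_sorted 0 n; rewrite -val_enum_ord sorted_map enumT.
pose f a := nth a (e K') (index a (e K)).
have idx a : (index a (e K) < n)%N by rewrite -[X in (_ < X)%N](size_e K) index_mem.
have f_inj : injective f.
  move=> a b; rewrite /f (set_nth_default b) ?size_e//.
  move/eqP; rewrite nth_uniq ?size_e// => /eqP ab.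
  by rewrite -(nth_index a (mem_e K a)) ab -[RHS](nth_index a (mem_e K b)).
have idxK a : a \in K -> index a (e K) = index a (enum K).
  by move=> aK; rewrite index_cat mem_enum aK.
have idxK_lt a : a \in K -> (index a (enum K) < size (enum K'))%N.
  by move=> aK; rewrite -cardE -KK' cardE index_mem mem_enum.
have fK a : a \in K -> f a = nth a (enum K') (index a (enum K)).
  by move=> aK; rewrite /f idxK// nth_cat idxK_lt.
have f_lt a b : a \in K -> b \in K -> (a < b)%N -> (f a < f b)%N.
  move=> aK bK ab; rewrite !fK// (set_nth_default b) ?idxK_lt//.
  have tr : transitive (fun a b : 'I_n => (a < b)%N) by move=> ? ? ?; apply: ltn_trans.
  apply: (sorted_ltn_nth tr _ (sorted_e K')); rewrite ?inE ?idxK_lt//.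
  rewrite ltnNge leq_eqVlt; apply/negP => /orP[/eqP ba|ba].
    by move: ab; rewrite -(nth_index a (_ : b \in enum K)) ?mem_enum// ba
      nth_index ?mem_enum// ltnn.
  have := sorted_ltn_nth tr a (sorted_e K) (index b (enum K)) (index a (enum K)).
  rewrite !inE !index_mem !mem_enum aK bK => /(_ isT isT ba).
  by rewrite !nth_index ?mem_enum// ltnNge ltnW.
exists (perm f_inj); split.
  apply/eqP; rewrite eqEcard; apply/andP; split.
    apply/fintype.subsetP => _ /imsetP[a aK ->]; rewrite permE fK//.
    by rewrite -mem_enum mem_nth ?idxK_lt.
  by rewrite card_imset ?KK'//; exact: perm_inj.
move=> a b aK bK; rewrite !permE.
have [ab|ba|/val_inj ->] := ltngtP a b; last by rewrite leqnn.
  by rewrite ltnW// f_lt.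
by apply/negbTE; rewrite -ltnNge f_lt.
Qed.

(** * Entry times and relabelling of candidates *)

Section Entry.
Variables (n m : nat).
Implicit Types (h s r : seq (object n m)) (o : object n m) (c : 'I_n) (K : {set 'I_n}).
Implicit Types (ki : nat * nat) (p : {perm 'I_n}).

(** The stopping-time property of [entry]: whether the process enters ki at time t is decided by the
    first t objects alone ([entryE]). *)
Definition first_visit ki h : bool :=
  (state h == ki) && ~~ has (fun t => state (take t h) == ki) (iota 0 (size h)).

Lemma entryE ki s t : (t <= size s)%N ->
  (entry ki s == t) = first_visit ki (take t s).
Proof.
move=> ts; rewrite /entry /first_visit size_takel//.
have -> : iota 0 (size s).+1 = iota 0 t ++ t :: iota t.+1 (size s - t).
  rewrite -[t :: _]/(iota t (size s - t).+1) -[X in iota X (size s - t).+1]add0n.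
  by rewrite -iotaD; congr iota; lia.
rewrite find_cat size_iota.
have -> : has (fun t' => state (take t' s) == ki) (iota 0 t) =
          has (fun t' => state (take t' (take t s)) == ki) (iota 0 t).
  apply: eq_in_has => t'; rewrite mem_iota add0n => t't.
  by rewrite take_takel// ltnW.
case: ifPn => [ht|_]; last first.
  rewrite /= andbT; case: (_ == ki); first by rewrite addn0 eqxx.
  by rewrite addnS gtn_eqF// ltnS leq_addr.
rewrite andbF; apply/negbTE; rewrite neq_ltn.
have : has (fun t' => state (take t' s) == ki) (iota 0 t).
  rewrite (eq_in_has (a2 := fun t' => state (take t' (take t s)) == ki))// => t'.
  by rewrite mem_iota add0n => t't; rewrite take_takel// ltnW.
by rewrite has_find size_iota => ->.
Qed.

Lemma visitsE ki s : visits ki s = (entry ki s <= size s)%N.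
Proof. by rewrite /visits has_find size_iota. Qed.

Lemma first_visit_entry ki s : visits ki s ->
  first_visit ki (take (entry ki s) s).
Proof. by rewrite visitsE => es; rewrite -entryE. Qed.

Definition relabel p h : seq (object n m) := [seq (p o.1, o.2) | o <- h].

Lemma seen_relabel p h : seen (relabel p h) = p @: seen h.
Proof.
apply/setP => c; rewrite inE /unzip1 -map_comp; apply/mapP/imsetP.
  by case=> x xh ->; exists x.1 => //; rewrite inE map_f.
by case=> d; rewrite inE => /mapP[x xh ->] ->; exists x.
Qed.

Lemma state_relabel p h :
  {in seen h &, forall a b, (p a <= p b)%N = (a <= b)%N} ->
  state (relabel p h) = state h.
Proof.
move=> pm; rewrite /state !ncandidatesE seen_relabel card_imset; last exact: perm_inj.
congr pair; rewrite count_map; apply: eq_in_count => o oh /=.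
rewrite /maximal all_map; apply: eq_in_all => o' oh' /=.
by rewrite pm// inE map_f.
Qed.

Lemma seen_take h t : seen (take t h) \subset seen h.
Proof.
apply/fintype.subsetP => c; rewrite !inE /unzip1 map_take.
exact: mem_take.
Qed.

Lemma first_visit_relabel ki p h :
  {in seen h &, forall a b, (p a <= p b)%N = (a <= b)%N} ->
  first_visit ki (relabel p h) = first_visit ki h.
Proof.
move=> pm; rewrite /first_visit state_relabel// size_map; congr (_ && ~~ _).
apply: eq_has => t; rewrite /relabel -map_take state_relabel//.
by move=> a b ah bh; apply: pm; exact: (fintype.subsetP (seen_take h t)).
Qed.

Lemma relabel_orders p s : s \in orders n m -> relabel p s \in orders n m.
Proof.
rewrite !mem_permutations => s_perm.
apply: uniq_perm; rewrite ?enum_uniq//.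
  rewrite map_inj_uniq ?(perm_uniq s_perm) ?enum_uniq//.
  by move=> [a b] [c d] [/perm_inj -> ->].
move=> [a b]; rewrite mem_enum !inE; apply/mapP.
exists (p^-1%g a, b); last by rewrite /= permKV.
by rewrite (perm_mem s_perm) mem_enum.
Qed.

Definition enters ki K s := visits ki s && (seen (take (entry ki s) s) == K).

(* An order-preserving map from K onto K' extends to a relabelling of all the *)
(* candidates, which does not change the states up to the entry in ki.        *)
Lemma count_enters ki K K' : #|K| = #|K'| ->
  count (enters ki K) (orders n m) = count (enters ki K') (orders n m).
Proof.
suff le : forall K K', #|K| = #|K'| -> (count (enters ki K) (orders n m) <=
    count (enters ki K') (orders n m))%N.
  by move=> e; apply/eqP; rewrite eqn_leq !le.
move=> {K K'} K K' /monotone_perm[p [pK pm]].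
rewrite -!size_filter -(size_map (relabel p)).
apply: uniq_leq_size.
  rewrite map_inj_uniq ?filter_uniq ?permutations_uniq//.
  by apply: inj_map => -[a b] [c d] [/perm_inj -> ->].
move=> _ /mapP[s + ->]; rewrite !mem_filter.
case/andP => /andP[vs /eqP sK] so; rewrite relabel_orders// andbT.
have fv := first_visit_entry vs; have es := vs; rewrite visitsE in es.
have rt : take (entry ki s) (relabel p s) = relabel p (take (entry ki s) s).
  by rewrite /relabel map_take.
have : entry ki (relabel p s) == entry ki s.
  by rewrite entryE ?size_map// rt first_visit_relabel// sK.
move=> /eqP ee; rewrite /enters visitsE ee size_map es rt seen_relabel sK pK eqxx.
by [].
Qed.

(** Makes the denominator of [Phi] nonzero. The witness first inspects all copies of the k - 1
    lowest candidates and i copies of the next one. *)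
Lemma exists_visit k i : (1 <= k <= n)%N -> (1 <= i <= m)%N ->
  has (visits (k, i)) (orders n m).
Proof.
move=> /andP[k1 kn] /andP[i1 im]; have kn' : (k.-1 < n)%N by lia.
have m0 : (0 < m)%N by lia.
pose M := Ordinal kn'.
pose P o := (o.1 < M)%N || ((o.1 == M) && (o.2 < i)%N).
pose h := [seq o <- enum {: 'I_n * 'I_m} | P o].
pose r := [seq o <- enum {: 'I_n * 'I_m} | ~~ P o].
have hP o : (o \in h) = P o by rewrite mem_filter mem_enum andbT.
apply/hasP; exists (h ++ r).
  by rewrite mem_permutations /h /r; apply/permPl; exact: perm_filterC.
have seenE : seen h = [set c : 'I_n | (c < k)%N].
  apply/setP => c; rewrite !inE; apply/mapP/idP => [[x]|ck].
    by rewrite hP /P => /orP[xM|/andP[/eqP xM _]] ->; rewrite ?xM /=; move: xM => /=; lia.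
  exists (c, Ordinal m0) => //; rewrite hP /P /= -val_eqE /=.
  by rewrite i1 andbT; lia.
have Mh : M \in seen h by rewrite seenE inE /= prednK.
have Mm : maximal h M.
  by apply/maximalP => d; rewrite seenE inE /=; lia.
apply/hasP; exists (size h).
  by rewrite mem_iota size_cat; lia.
rewrite take_size_cat//.
have -> : state h = (#|seen h|, count_mem M (unzip1 h)).
  by rewrite -(state_top Mh Mm) -ncandidatesE.
rewrite xpair_eqE; apply/andP; split.
  rewrite seenE -sum1dep_card -(big_ord_widen n (fun=> 1%N) kn) sum1_card.
  by rewrite card_ord.
rewrite count_map -size_filter -(card_uniqP (filter_uniq _ (filter_uniq _ (enum_uniq _)))).
have <- : #|finset.setX [set M] [set j : 'I_m | (j < i)%N]| = i.
  rewrite cardsX cards1 mul1n -sum1dep_card -(big_ord_widen m (fun=> 1%N) im).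
  by rewrite sum1_card card_ord.
apply/eqP/eq_card => -[c j]; rewrite !inE mem_filter mem_filter mem_enum /P /= andbT.
by case: eqP => [->|] //=; rewrite ltnn.
Qed.
End Entry.

(** * Averaging over the set of seen candidates *)

Section Average.
Variables (R : realType) (n m : nat).
Implicit Types (h s r : seq (object n m)) (o : object n m) (c : 'I_n) (K : {set 'I_n}).

(** Orders are split by their entry time t. Entry at t depends only on the first t objects, so the
    remaining ones can be reshuffled, and [sum_accepted] evaluates the proportion of successes. *)
Lemma count_success k i : (1 < m)%N -> (0 < k)%N ->
  (count (fun s => visits (k, i) s && success (k, i) s) (orders n m))%:R =
  \sum_(s <- orders n m | visits (k, i) s)
     value R (take (entry (k, i) s) s).
Proof.
move=> m1 k0; set ki := (k, i).
pose N := size (enum {: 'I_n * 'I_m}).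
have size_orders s : s \in orders n m -> size s = N.
  by rewrite mem_permutations => /perm_size.
have by_time (g : seq (object n m) -> R) : \sum_(s <- orders n m | visits ki s) g s =
    \sum_(t < N.+1) \sum_(s <- orders n m) (first_visit ki (take t s))%:R * g s.
  (* On an order that misses ki, [entry] is N + 1 and [inord] returns a meaningless index; [visits]
     excludes these orders. *)
  rewrite (partition_big (fun s => inord (entry ki s) : 'I_N.+1) predT)//=.
  apply: eq_bigr => t _; rewrite big_mkcond big_seq [RHS]big_seq.
  apply: eq_bigr => s /size_orders sN; rewrite -entryE ?sN -1?ltnS//.
  rewrite visitsE sN -val_eqE /=.
  case: leqP => [eN|Ne] /=; first by rewrite inordK//; case: eqP; rewrite ?mul1r ?mul0r.
  by rewrite gtn_eqF ?mul0r// (leq_trans (ltn_ord t)).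
rewrite -sum1_count big_mkcondr /= natr_sum !by_time.
apply: eq_bigr => t _.
pose f h r : R := (first_visit ki h)%:R *
  (if accepted h r is Some o then best o.1 else false)%:R.
transitivity (\sum_(s <- orders n m) f (take t s) (drop t s)).
  rewrite big_seq [RHS]big_seq; apply: eq_bigr => s /size_orders sN; rewrite /f.
  have [fv|_] := boolP (first_visit _ _); last by rewrite !mul0r.
  move: fv; rewrite -entryE ?sN -1?ltnS// => /eqP et.
  by rewrite /success et; case: accepted => [x|]//; case: best.
have tN : (t <= N)%N by rewrite -ltnS.
have fac0 : ((N - t)`!%:R : R) != 0 by rewrite pnatr_eq0 -lt0n fact_gt0.
(* The factor (N - t)! pays for the reshuffling of the objects after time t. *)
apply: (mulIf fac0); rewrite mulr_natr sum_permutations_drop ?enum_uniq//.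
rewrite mulr_suml big_seq [RHS]big_seq; apply: eq_bigr => s so.
have sN := size_orders _ so.
rewrite /f -mulr_sumr -mulrA.
have [fv|_] := boolP (first_visit _ _); last by rewrite !mul0r.
rewrite !mul1r sum_accepted//.
- have /eqP -> : entry ki s == t by rewrite entryE ?sN.
  by rewrite size_drop sN mulrC.
(* The empty history has state (0, 0), so k > 0 excludes entry at time 0. *)
- by apply: contraTneq fv => ->; rewrite /first_visit /= xpair_eqE; case: (k) k0.
by rewrite cat_take_drop -mem_permutations.
Qed.

(** The value at the entry depends only on the set of seen candidates, and by [count_enters] each
    k-subset is that set for the same number N of orders. *)
Lemma Phi_win k i : (1 < m)%N -> (1 <= k <= n)%N -> (1 <= i <= m)%N ->
  Phi R m n i k =
  (\sum_(K : {set 'I_n} | #|K| == k) win R m (n - k) (m - i) K) / 'C(n, k)%:R.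
Proof.
move=> m1 kn im; have /andP[k0 kn'] := kn.
have Ck : ('C(n, k)%:R : R) != 0 by rewrite pnatr_eq0 -lt0n bin_gt0.
set ki := (k, i).
have seen_entry s : visits ki s -> #|seen (take (entry ki s) s)| = k /\
    (state (take (entry ki s) s)).2 = i.
  move=> /first_visit_entry/andP[/eqP st _].
  by rewrite st -ncandidatesE -[LHS]/(state _).1 st.
pose K0 : {set 'I_n} := [set c : 'I_n | (c < k)%N].
have K0k : #|K0| = k.
  by rewrite -sum1dep_card -(big_ord_widen n (fun=> 1%N) kn') sum1_card card_ord.
pose N := count (enters ki K0) (orders n m).
have avg (g : {set 'I_n} -> R) :
    \sum_(s <- orders n m | visits ki s) g (seen (take (entry ki s) s)) =
    N%:R * \sum_(K : {set 'I_n} | #|K| == k) g K.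
  rewrite (partition_big (fun s => seen (take (entry ki s) s))
    (fun K : {set 'I_n} => #|K| == k))/=; last by move=> s /seen_entry[-> _].
  rewrite mulr_sumr; apply: eq_bigr => K /eqP Kk.
  rewrite (eq_bigr (fun=> g K)); last by move=> s /andP[_ /eqP ->].
  rewrite big_const_seq iter_addr_0 mulr_natl; congr (_ *+ _).
  by rewrite /N (@count_enters _ _ ki K0 K) ?K0k.
have visits_count : (count (visits ki) (orders n m))%:R = N%:R * 'C(n, k)%:R :> R.
  rewrite -sum1_count natr_sum (avg (fun=> 1)).
  rewrite sumr_const; congr (_ * _%:R).
  by rewrite -[in RHS](card_ord n) -card_draws; apply: eq_card => K; rewrite !inE.
have N0 : (N%:R : R) != 0.
  have := @exists_visit n m k i kn im; rewrite has_count -/ki lt0n -(pnatr_eq0 R).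
  by rewrite visits_count mulf_eq0 negb_or => /andP[].
rewrite /Phi visits_count count_success//.
rewrite (eq_bigr (fun s => win R m (n - k) (m - i) (seen (take (entry ki s) s)))).
  by rewrite avg invfM mulrACA divff// mul1r.
move=> s /seen_entry[sk si]; rewrite /value -/ki si.
by congr win; rewrite -sk -[X in (X - _)%N](card_ord n) -(cardsC (seen (take (entry ki s) s))) addKn.
Qed.
End Average.

(** * Recurrence *)

Section Recurrence.
Variables (R : realType) (n m : nat).
Implicit Types (c : 'I_n) (K : {set 'I_n}).

(** When no candidate is unseen, the maximal candidate is the best one and stays maximal, so its
    last copy is certain to be accepted unless it has already passed (j = 0). *)
Lemma win0 j K : has_best K -> win R m 0 j K = (0 < j)%:R.
Proof.
move=> bK; elim: j => [|j IH]; first by rewrite /= addr0 mul0r.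
have -> : win R m 0 j.+1 K = (j.+1%:R *
    (if j is 0%N then (has_best K)%:R else win R m 0 j K) + 0) / (j.+1 + m * 0)%:R.
  by [].
rewrite muln0 addn0 addr0 mulrAC divff ?pnatr_eq0// mul1r.
by case: j IH => [_|j IH]; [rewrite bK|exact: IH].
Qed.

(** The subsets that contain the best candidate number C(n-1, k-1), a proportion k / n of all
    k-subsets. This is the source of k / n in the recurrence. *)
Lemma sum_has_best k : (0 < k <= n)%N ->
  n%:R * \sum_(K : {set 'I_n} | #|K| == k) (has_best K)%:R =
  k%:R * 'C(n, k)%:R :> R.
Proof.
move=> /andP[k0 kn]; have n1 : (n.-1 < n)%N by lia.
pose M := Ordinal n1.
have bM c : best c = (c == M).
  apply/forallP/eqP => [/(_ M) /= cM|-> d /=]; last by have := ltn_ord d; lia.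
  by apply: val_inj => /=; have := ltn_ord c; lia.
have bK K : has_best K = (M \in K).
  apply/existsP/idP => [[c /andP[cK]]|MK]; first by rewrite bM => /eqP <-.
  by exists M; rewrite MK bM eqxx.
suff -> : \sum_(K : {set 'I_n} | #|K| == k) (has_best K)%:R = 'C(n.-1, k.-1)%:R :> R.
  by rewrite -!natrM mul_bin_diag prednK.
have total : (\sum_(K : {set 'I_n} | #|K| == k) 1 = 'C(n, k))%N.
  rewrite sum1dep_card -[in RHS](card_ord n) -card_draws.
  by apply: eq_card => K; rewrite !inE.
rewrite -natr_sum; congr _%:R; apply/eqP.
move: total; rewrite (bigID (fun K => M \in K)) /=.
have -> : (\sum_(K : {set 'I_n} | (#|K| == k) && (M \notin K)) 1 = 'C(n.-1, k))%N.
  have <- : #|~: [set M]| = n.-1 by rewrite cardsC1 card_ord.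
  rewrite sum1dep_card -cards_draws; apply: eq_card => K; rewrite !inE andbC.
  congr (_ && _); rewrite finset.subsetC finset.sub1set inE.
  by [].
have -> : ('C(n, k) = 'C(n.-1, k) + 'C(n.-1, k.-1))%N.
  by case: (n) (leq_trans k0 kn) => [//|n'] _; case: (k) k0 => [//|k'] _; rewrite binS.
rewrite addnC => /eqP; rewrite eqn_add2l => /eqP <-.
rewrite [X in _ == X]big_mkcondr /=; apply/eqP/eq_bigr => K _.
by rewrite bK; case: (_ \in _).
Qed.

(** A k-subset with a point outside it amounts to a (k+1)-subset with a marked point. *)
Lemma sum_insert k (f : 'I_n -> {set 'I_n} -> R) :
  \sum_(K : {set 'I_n} | #|K| == k) \sum_(c | c \notin K) f c (c |: K) =
  \sum_(K : {set 'I_n} | #|K| == k.+1) \sum_(c in K) f c K.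
Proof.
rewrite !pair_big_dep /=.
rewrite (reindex_onto (fun p : {set 'I_n} * 'I_n => (p.1 :\ p.2, p.2))
  (fun p => (p.2 |: p.1, p.2))) /=; last first.
  by move=> [K c] /andP[_ cK]; rewrite /= setU1K.
apply: eq_big => [[K c]|[K c]] /=.
  rewrite !inE eqxx /= andbT xpair_eqE eqxx andbT.
  have [cK|cK] := boolP (c \in K); last first.
    rewrite andbF; apply/negbTE; apply/negP => /andP[_ /eqP KE].
    by move: cK; rewrite -KE finset.setU11.
  by rewrite finset.setD1K// eqxx !andbT (cardsD1 c K) cK.
by move=> /andP[_ /eqP[-> ]].
Qed.

Lemma above_max K c : c \in K ->
  above (K :\ c) c = [forall d in K, (d <= c)%N].
Proof.
move=> cK; apply: eq_forallb => d; rewrite !inE.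
by case: eqP => [->|] //=; rewrite leqnn implybT.
Qed.

(** Only the maximum of K lies above all the other elements, so one choice of c gives i and the k
    others give j. *)
Lemma sum_above u i j k K : #|K| = k.+1 ->
  \sum_(c in K) win R m u (if above (K :\ c) c then i else j) K =
  win R m u i K + k%:R * win R m u j K.
Proof.
move=> Kk.
have /card_gt0P[c0 c0K] : (0 < #|K|)%N by rewrite Kk.
case: (@arg_maxnP _ c0 (fun c => c \in K) (fun c => c : nat) c0K) => M MK Mmax.
rewrite (bigD1 M)//= above_max// (introT forall_inP Mmax).
congr (_ + _); rewrite (eq_bigr (fun=> win R m u j K)) => [|c /andP[cK cM]].
  rewrite sumr_const mulr_natl; congr (_ *+ _).
  have -> : k = #|K :\ M| by move: Kk; rewrite (cardsD1 M) MK => -[].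
  by apply: eq_card => c; rewrite !inE andbC.
rewrite above_max// ifF//; apply/negbTE; apply: contraNN cM => /forall_inP cmax.
by apply/eqP/val_inj/eqP; rewrite eqn_leq; apply/andP; split; [exact: Mmax|exact: cmax].
Qed.

Hypothesis m1 : (1 < m)%N.

Lemma Phi_last i : (0 < n)%N -> (1 <= i <= m)%N -> Phi R m n i n = (i < m)%:R.
Proof.
move=> n0 im; rewrite Phi_win ?n0 ?leqnn// binn divr1 subnn.
have KT K : (#|K| == n) = (K == ~: finset.set0).
  apply/eqP/eqP => [Kn|->]; last by rewrite finset.setC0 cardsT card_ord.
  by apply/eqP; rewrite finset.setC0 eqEcard finset.subsetT cardsT card_ord Kn /=.
rewrite (eq_bigl _ _ KT) big_pred1_eq win0 ?subn_gt0//.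
have n1 : (n.-1 < n)%N by rewrite prednK.
apply/existsP; exists (Ordinal n1); rewrite !inE /=.
by apply/forallP => d /=; rewrite -ltnS prednK.
Qed.

(** Sum [winE] over the k-subsets K, rewrite the insertions by [sum_insert] and [sum_above], and
    divide by C(n, k). *)
Lemma Phi_rec i k : (1 <= k < n)%N -> (1 <= i <= m)%N ->
  ((m - i) + m * (n - k))%:R * Phi R m n i k =
  (m - i)%:R * (if i.+1 == m then k%:R / n%:R else Phi R m n i.+1 k) +
  m%:R * (n - k)%:R / k.+1%:R *
    (Phi R m n 1 k.+1 + k%:R * Phi R m n i k.+1).
Proof.
move=> /andP[k0 kn] im; have /andP[i0 i_le] := im.
have C0 : ('C(n, k)%:R : R) != 0 by rewrite pnatr_eq0 -lt0n bin_gt0 ltnW.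
have C1 : ('C(n, k.+1)%:R : R) != 0 by rewrite pnatr_eq0 -lt0n bin_gt0.
have n0 : (n%:R : R) != 0 by rewrite pnatr_eq0 -lt0n (leq_trans _ kn).
have kS : (k.+1%:R : R) != 0 by rewrite pnatr_eq0.
have CE : k.+1%:R * 'C(n, k.+1)%:R = (n - k)%:R * 'C(n, k)%:R :> R.
  by rewrite -!natrM mul_bin_left.
set u := (n - k)%N; set j := (m - i)%N.
pose S u j k : R := \sum_(K : {set 'I_n} | #|K| == k) win R m u j K.
have SE : (j + m * u)%:R * S u j k =
    j%:R * (if j == 1%N then \sum_(K : {set 'I_n} | #|K| == k) (has_best K)%:R
            else S u j.-1 k) +
    m%:R * (S u.-1 m.-1 k.+1 + k%:R * S u.-1 j k.+1).
  rewrite mulr_sumr (eq_bigr (fun K => j%:R * (if j == 1%N then (has_best K)%:R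
      else win R m u j.-1 K) + m%:R * \sum_(c | c \notin K)
      win R m u.-1 (if above K c then m.-1 else j) (c |: K))); last first.
    move=> K /eqP Kk; apply: winE; first exact: ltnW.
    by rewrite cardsCs finset.setCK card_ord Kk.
  rewrite big_split /= -!mulr_sumr; congr (_ * _ + _ * _).
    by case: ifP.
  rewrite (eq_bigr (fun K : {set 'I_n} => \sum_(c | c \notin K) win R m u.-1
     (if above ((c |: K) :\ c) c then m.-1 else j) (c |: K))); last first.
    by move=> K _; apply: eq_bigr => c cK; rewrite setU1K.
  rewrite (sum_insert k (fun c K => win R m u.-1
     (if above (K :\ c) c then m.-1 else j) K)).
  rewrite (eq_bigr (fun K => win R m u.-1 m.-1 K + k%:R * win R m u.-1 j K)).
    by rewrite big_split /= -mulr_sumr.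
  by move=> K /eqP Kk; rewrite (sum_above _ _ _ Kk).
have PE i' : (1 <= i' <= m)%N -> Phi R m n i' k.+1 = S u.-1 (m - i')%N k.+1 / 'C(n, k.+1)%:R.
  by move=> im'; rewrite Phi_win// /u -subnS.
have Pik : Phi R m n i k = S u j k / 'C(n, k)%:R by rewrite Phi_win ?k0 ?(ltnW kn).
rewrite (PE i im) (PE 1%N (ltnW m1)) subn1 -/j Pik.
have -> : j%:R * (if i.+1 == m then k%:R / n%:R else Phi R m n i.+1 k) =
    j%:R * (if j == 1%N then \sum_(K : {set 'I_n} | #|K| == k) (has_best K)%:R
            else S u j.-1 k) / 'C(n, k)%:R.
  have [j1|j1] := eqVneq j 1%N.
    have -> : i.+1 == m by rewrite /j in j1; lia.
    have := @sum_has_best k; rewrite k0 ltnW// => /(_ isT) E.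
    rewrite -mulrA; congr (_ * _); apply: (mulfI n0); rewrite [RHS]mulrA E.
    by rewrite mulrCA divff// mulr1 mulfK.
  (* For i = m the factor m - i is zero, so the value of [Phi] at index m + 1 does not matter. *)
  have [j0|j0] := eqVneq j 0%N; first by rewrite j0 !mul0r.
  have -> : (i.+1 == m) = false by rewrite /j in j1 j0; lia.
  rewrite Phi_win ?k0 ?(ltnW kn)//; last by rewrite /j in j1 j0; lia.
  by rewrite -mulrA subnS.
rewrite [LHS]mulrA SE [LHS]mulrDl; congr (_ + _).
rewrite -[LHS]mulrA -[RHS]mulrA -[RHS]mulrA; congr (_ * _).
(* Passing from k-subsets to (k+1)-subsets changes the normalization by C(n, k+1) / C(n, k) = (n -
   k) / (k + 1). *)
have -> : (n - k)%:R = k.+1%:R * 'C(n, k.+1)%:R / 'C(n, k)%:R :> R.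
  by rewrite CE mulfK.
by field; rewrite C1 C0 andbT addrC natr1.
Qed.
End Recurrence.

(** * Limit *)

Local Open Scope classical_set_scope.

Section RatioFilter.
Variable R : realType.
Implicit Types (x : R) (nk : nat * nat).

(** Encodes n tending to infinity with 0 < k < n and k / n tending to x as a filter on pairs (n, k),
    so that the algebra of limits applies. *)
Definition ratio_nbhs x : set_system (nat * nat) :=
  [set A | exists2 d : R, 0 < d & exists N : nat, forall n k : nat,
     (N < n)%N -> (0 < k < n)%N -> `|k%:R / n%:R - x| < d -> A (n, k)].

Global Instance ratio_nbhs_filter x : Filter (ratio_nbhs x).
Proof.
split.
- by exists 1 => //; exists 0%N.
- move=> A B [d d0 [N HN]] [e e0 [M HM]]; exists (Num.min d e).
    by rewrite lt_min d0.
  exists (maxn N M) => n k; rewrite gtn_max => /andP[Nn Mn] kn.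
  by rewrite lt_min => /andP[kd ke]; split; [exact: HN|exact: HM].
move=> A B AB [d d0 [N HN]]; exists d => //; exists N => n k Nn kn kd.
by apply: AB; exact: HN.
Qed.

Lemma ratio_nbhs_lt x : \forall nk \near ratio_nbhs x, (0 < nk.2 < nk.1)%N.
Proof. by exists 1 => //; exists 0%N. Qed.

Lemma cvg_ratio x : nk.2%:R / nk.1%:R @[nk --> ratio_nbhs x] --> x.
Proof.
apply/cvgrPdist_lt => e e0; exists e => //; exists 0%N => n k _ _ /=.
by rewrite distrC.
Qed.

Lemma exists_inv_lt (e : R) : 0 < e ->
  exists N : nat, forall n, (N < n)%N -> n%:R^-1 < e.
Proof.
move=> e0; exists (Num.truncn e^-1) => n Nn.
have n0 : 0 < n%:R :> R by rewrite ltr0n (leq_ltn_trans _ Nn).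
rewrite invf_plt ?posrE//.
by rewrite (lt_le_trans (truncnS_gt _))// ler_nat.
Qed.

Lemma cvg_inv_size x : nk.1%:R^-1 @[nk --> ratio_nbhs x] --> (0 : R).
Proof.
apply/cvgrPdist_lt => e e0; have [N HN] := exists_inv_lt e0.
exists 1 => //; exists N => n k Nn _ _ /=.
by rewrite sub0r normrN ger0_norm ?invr_ge0// HN.
Qed.

Lemma telescope_dist (a : nat -> R) (L e : R) (p q : nat) : (p <= q)%N ->
  (forall k, (p <= k < q)%N -> `|a k.+1 - a k - L| <= e) ->
  `|a q - a p - L * (q - p)%:R| <= e * (q - p)%:R.
Proof.
move=> pq; rewrite -(subnKC pq); elim: (q - p)%N => {q pq} [|q IH] H.
  by rewrite addn0 subnn !mulr0 subrr subr0 normr0.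
have -> : (p + q.+1 - p = (p + q - p).+1)%N by lia.
rewrite addnS -natr1 !mulrDr !mulr1.
have -> : a (p + q).+1 - a p - (L * (p + q - p)%:R + L) =
  (a (p + q)%N - a p - L * (p + q - p)%:R) + (a (p + q).+1 - a (p + q)%N - L) by ring.
rewrite (le_trans (ler_normD _ _))// lerD//.
  by apply: IH => k /andP[pk kq]; apply: H; rewrite pk addnS ltnS ltnW.
by apply: H; rewrite leq_addr addnS ltnSn.
Qed.

Lemma cvg_truncn (p : R) : 0 <= p ->
  (Num.truncn (p * n%:R))%:R / n%:R @[n --> \oo] --> p.
Proof.
move=> p0; apply/cvgrPdist_le => e e0; have [N HN] := exists_inv_lt e0.
near=> n.
have Nn : (N < n)%N by near: n; exists N.+1.
have n0 : 0 < n%:R :> R by rewrite ltr0n (leq_ltn_trans _ Nn).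
have /andP[t1 t2] := truncn_itv (mulr_ge0 p0 (ltW n0)).
rewrite -natr1 in t2.
have -> : p - (Num.truncn (p * n%:R))%:R / n%:R =
    (p * n%:R - (Num.truncn (p * n%:R))%:R) / n%:R.
  by field; rewrite gt_eqF.
rewrite ger0_norm; last by rewrite divr_ge0 ?subr_ge0 ?ler0n.
rewrite (le_trans _ (ltW (HN _ Nn)))// ler_pdivrMr// mulVf ?gt_eqF//.
by lra.
Unshelve. all: by end_near. Qed.

(** * Derivatives from scaled increments *)

Section Derivative.
Variables (a : nat -> nat -> R) (f : R -> R) (x L : R).
Hypothesis x01 : 0 < x <= 1.
Hypothesis af : forall z : R, 0 < z <= 1 ->
  a n (maxn 1 (Num.truncn (z * n%:R))) @[n --> \oo] --> f z.
Hypothesis aL :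
  nk.1%:R * (a nk.1 nk.2.+1 - a nk.1 nk.2) @[nk --> ratio_nbhs x] --> L.

(** Between the floors of p n and q n every increment of [a n] is within e / n of L / n;
    [telescope_dist] adds them up, and n tends to infinity at fixed p and q. *)
Lemma increment_dist (e : R) : 0 < e -> exists2 d : R, 0 < d &
  forall p q : R, 0 < p -> p < q -> q <= 1 -> `|p - x| < d -> `|q - x| < d ->
  `|f q - f p - L * (q - p)| <= e * (q - p).
Proof.
move=> e0; have /cvgrPdist_le/(_ _ e0)[d d0 [N HN]] := aL.
(* The indices j met below satisfy p - 1 / n < j / n <= q; once 1 / n < d / 2, this keeps j / n
   within d of x. *)
exists (d / 2); first by rewrite divr_gt0.
move=> p q p0 pq q1 px qx.
have q0 := lt_trans p0 pq; have p1 := le_trans (ltW pq) q1.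
have d20 : 0 < d / 2 by rewrite divr_gt0.
pose k z n := Num.truncn (z * n%:R : R).
have cf (z : R) : 0 < z -> z <= 1 -> a n (k z n) @[n --> \oo] --> f z.
  move=> z0 z1; apply: cvg_trans (af (z := z) _); last by rewrite z0.
  apply: near_eq_cvg; have [M HM] := exists_inv_lt z0.
  near=> n; have Mn : (M < n)%N by near: n; exists M.+1.
  have n0 : 0 < n%:R :> R by rewrite ltr0n (leq_ltn_trans _ Mn).
  congr (a n _); apply/maxn_idPr; rewrite truncn_gt0.
  by rewrite -ler_pdivrMr// mul1r ltW// HM.
have ck (z : R) : 0 < z -> (k z n)%:R / n%:R @[n --> \oo] --> z.
  by move=> z0; apply: cvg_truncn; exact: ltW.
have lhs : `|a n (k q n) - a n (k p n) - L * ((k q n)%:R / n%:R - (k p n)%:R / n%:R)|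
    @[n --> \oo] --> `|f q - f p - L * (q - p)|.
  apply: cvg_norm; apply: cvgB.
    by apply: cvgB; apply: cf => //; exact: ltW.
  by apply: cvgMr; apply: cvgB; exact: ck.
have rhs : e * ((k q n)%:R / n%:R - (k p n)%:R / n%:R) @[n --> \oo] --> e * (q - p).
  by apply: cvgMr; apply: cvgB; exact: ck.
apply: (ler_cvg_to lhs rhs).
have [M HM] := exists_inv_lt d20; have [M' HM'] := exists_inv_lt p0.
near=> n.
have Nn : (N < n)%N by near: n; exists N.+1.
have Mn : (M < n)%N by near: n; exists M.+1.
have M'n : (M' < n)%N by near: n; exists M'.+1.
have n0 : 0 < n%:R :> R by rewrite ltr0n (leq_ltn_trans _ Nn).
have kpq : (k p n <= k q n)%N by apply: le_truncn; rewrite (ler_pM2r n0) ltW.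
rewrite -mulrBl -natrB// !mulrA.
have := @telescope_dist (a n) (L / n%:R) (e / n%:R) _ _ kpq.
rewrite mulrAC [e / _ * _]mulrAC; apply => j /andP[pj jq].
have /andP[p_lo p_hi] := truncn_itv (mulr_ge0 (ltW p0) (ltW n0)).
have /andP[q_lo q_hi] := truncn_itv (mulr_ge0 (ltW q0) (ltW n0)).
rewrite -/(k p n) -/(k q n) -?natr1 in p_lo p_hi q_lo q_hi.
have j0 : (0 < j)%N.
  rewrite (leq_trans _ pj)// truncn_gt0 -ler_pdivrMr// mul1r ltW//.
  by rewrite HM'.
have jn : (j < n)%N.
  rewrite (leq_trans jq)// -(ler_nat R) (le_trans q_lo)//.
  by rewrite ler_piMl// ltW.
have jx : `|j%:R / n%:R - x| < d.
  have jp : p < j%:R / n%:R + n%:R^-1.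
    rewrite -[X in _ + X]mul1r -mulrDl ltr_pdivlMr// (lt_le_trans p_hi)//.
    by rewrite lerD2r ler_nat.
  have jq' : j%:R / n%:R <= q.
    rewrite ler_pdivrMr// (le_trans _ q_lo)// ler_nat ltnW//.
  have := HM _ Mn; move: px qx; rewrite !ltr_norml.
  by move=> /andP[? ?] /andP[? ?] ?; apply/andP; split; lra.
have := HN n j Nn; rewrite j0 jn => /(_ isT jx) /=.
rewrite distrC => H.
have -> : a n j.+1 - a n j - L / n%:R = (n%:R * (a n j.+1 - a n j) - L) / n%:R.
  by field; rewrite gt_eqF.
rewrite normrM [X in _ * X]ger0_norm ?invr_ge0 ?(ltW n0)//.
by rewrite ler_pM2r// invr_gt0.
Unshelve. all: by end_near. Qed.

Lemma within_dnbhs_proper : ProperFilter (within `]0, 1]%classic x^').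
Proof.
split; last exact: within_filter.
rewrite /within /= => -[d /= d0 H].
have /andP[x0 x1] := x01.
(* A point to the left of x, so that it lies in ]0, 1] even for x = 1. *)
pose z := Num.max (x - d / 2) (x / 2).
have zx : z < x by rewrite gt_max; apply/andP; split; lra.
have z0 : 0 < z by rewrite lt_max; apply/orP; right; lra.
have zd : x - d / 2 <= z by rewrite le_max lexx.
apply: (H z) => /=.
- by rewrite ltr_norml; apply/andP; split; lra.
- by rewrite lt_eqF.
by rewrite in_itv /= z0; lra.
Qed.

(** The increment estimate between x and z, taken in increasing order, is the definition of the
    derivative after division by z - x. *)
Lemma derive_within_ratio : derive_within `]0, 1]%classic f x = L.
Proof.
have PF := within_dnbhs_proper.
apply: cvg_lim => //; apply/cvgrPdist_le => e e0.
have [d d0 Hd] := increment_dist e0.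
have /andP[x0 x1] := x01.
exists d => //= z /= zx zNx; rewrite in_itv /= => /andP[z0 z1].
have xx : `|x - x| < d by rewrite subrr normr0.
have zx' : `|z - x| < d by rewrite distrC.
rewrite /diff_quotient.
have zx0 : z - x != 0 by rewrite subr_eq0.
have -> : L - (f z - f x) / (z - x) = - (f z - f x - L * (z - x)) / (z - x).
  by field.
rewrite normrM normrN normfV ler_pdivrMr ?normr_gt0//.
have [zx1|xz1|/eqP] := ltgtP z x; last by rewrite (negbTE zNx).
  rewrite (ltr0_norm (_ : z - x < 0)) ?subr_lt0// opprB.
  rewrite -normrN (_ : - (f z - f x - L * (z - x)) = f x - f z - L * (x - z)).
    exact: Hd.
  by ring.
rewrite (gtr0_norm (_ : 0 < z - x)) ?subr_gt0//.
exact: Hd.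
Qed.

End Derivative.
End RatioFilter.

Lemma phi_ratio (R : realType) m n i k : (0 < k <= n)%N ->
  phi m n i (k%:R / n%:R : R) = Phi R m n i k.
Proof.
move=> /andP[k0 kn].
have n0 : n%:R != 0 :> R by rewrite pnatr_eq0 -lt0n (leq_trans k0).
by rewrite /phi divfK// natrK; congr Phi; apply/maxn_idPr.
Qed.

Lemma uniform_cvg_dist (R : realType) (f_ : nat -> R -> R) (f : R -> R) :
  {uniform `[0, 1]%classic, f_ @ \oo --> f} ->
  forall e : R, 0 < e -> exists N : nat, forall n, (N <= n)%N ->
    forall z, 0 <= z <= 1 -> `|f z - f_ n z| < e.
Proof.
move=> fu e e0; pose E := [set xy : R * R | ball xy.1 e xy.2].
have nE : nbhs (f : {uniform` `[0, 1]%classic -> R})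
    [set h : R -> R | forall z, `[0, 1]%classic z -> E (f z, h z)].
  apply/uniform_nbhs; exists E; split => //.
  exact: (entourage_ball _ (PosNum e0)).
have [N _ HN] := fu _ nE; exists N => n Nn z z01.
by have := HN n Nn z; rewrite /= in_itv /= => /(_ z01).
Qed.

(** * The limit functions and their derivatives *)

Section Limit.
Variables (R : realType) (m : nat) (y : nat -> R -> R).
Hypothesis m1 : (1 < m)%N.
Hypothesis hunif : forall i : nat, (1 <= i <= m)%N ->
  {uniform `[0, 1]%classic, (fun n : nat => @phi R m n i) @ \oo --> y i}.
Hypothesis hcont : forall i : nat, (1 <= i <= m)%N ->
  {within `]0, 1]%classic, continuous (y i)}.

Lemma cvg_phi i (z : R) : (1 <= i <= m)%N -> 0 <= z <= 1 ->
  phi m n i z @[n --> \oo] --> y i z.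
Proof.
move=> im z01; apply/cvgrPdist_lt => e /(uniform_cvg_dist (hunif im))[N HN].
by exists N => // n Nn; exact: HN.
Qed.

Lemma y1E i : (1 <= i <= m)%N -> y i 1 = (i < m)%:R.
Proof.
move=> im; have c := cvg_phi im (z := 1).
have {c} : phi m n i (1 : R) @[n --> \oo] --> y i 1 by apply: c; rewrite ler01 lexx.
move/(@cvg_lim _ (@Rhausdorff R)) => <-.
apply: cvg_lim; first exact: Rhausdorff.
apply: cvg_near_cst; exists 1%N => // n /= n0.
have nn : (0 < n <= n)%N by rewrite n0 leqnn.
by rewrite -(Phi_last R m1 n0 im) -(phi_ratio R m i nn) divff// pnatr_eq0 -lt0n.
Qed.

(** [Phi] at k + s is [phi] at z = (k + s) / n. As z moves with n, uniformity gives closeness to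
    y_i(z), and continuity brings y_i(z) to y_i(x). The shift s covers both k and k + 1. *)
Lemma cvg_Phi_shift s i (x : R) : (s <= 1)%N -> (1 <= i <= m)%N -> 0 < x <= 1 ->
  Phi R m nk.1 i (nk.2 + s) @[nk --> ratio_nbhs x] --> y i x.
Proof.
move=> s1 im x01; apply/cvgrPdist_lt => e e0.
have e20 : 0 < e / 2 by rewrite divr_gt0.
have [N HN] := uniform_cvg_dist (hunif im) e20.
have /subspace_continuousP/(_ x) := hcont im.
rewrite /= in_itv /= => /(_ x01)/cvgrPdist_lt/(_ _ e20)[d /= d0 Hd].
have d20 : 0 < d / 2 by rewrite divr_gt0.
have [M HM] := exists_inv_lt d20.
exists (d / 2) => //; exists (maxn N M) => n k.
rewrite gtn_max => /andP[Nn Mn] /andP[k0 kn] kx /=.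
have n0 : 0 < n%:R :> R by rewrite ltr0n (leq_ltn_trans _ kn).
have kn' : (0 < k + s <= n)%N by lia.
pose z : R := (k + s)%:R / n%:R.
have z0 : 0 < z by rewrite divr_gt0// ltr0n; case/andP: kn'.
have z1 : z <= 1 by rewrite ler_pdivrMr// mul1r ler_nat; case/andP: kn'.
have zx : `|x - z| < d.
  have -> : x - z = - (k%:R / n%:R - x) - s%:R / n%:R.
    by rewrite /z natrD; field; rewrite gt_eqF.
  rewrite (le_lt_trans (ler_normB _ _))// normrN.
  have : `|s%:R / n%:R| <= n%:R^-1 :> R.
    rewrite ger0_norm; last by rewrite divr_ge0 ?ler0n.
    by rewrite ler_piMl ?invr_ge0 ?ler0n// lern1.
  by have := HM n Mn; lra.
rewrite -(phi_ratio R m i kn') -/z.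
have -> : y i x - phi m n i z = (y i x - y i z) + (y i z - phi m n i z) by ring.
rewrite (le_lt_trans (ler_normD _ _))// [X in _ < X](splitr e) ltrD//.
  by apply: Hd => //=; rewrite in_itv /= z0.
by apply: HN; [exact: ltnW|rewrite (ltW z0)].
Qed.

(** Limit of the term that a further copy of the maximal candidate contributes to [Phi_rec]; for i =
    m - 1 that copy is accepted and k / n tends to x. *)
Definition next_limit i (x : R) : R := if i.+1 == m then x else y i.+1 x.

(** Limit of the increment formula given by [Phi_rec]. For i < m it contains 1 / (1 - x), hence the
    restriction to x < 1. *)
Lemma derive_limit i (x : R) : (1 <= i <= m)%N -> 0 < x <= 1 ->
  (i < m)%N ==> (x < 1) ->
  derive_within `]0, 1]%classic (y i) x =
  (y i x - y 1 x) / x +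
  (m - i)%:R / m%:R * ((1 - x)^-1 * (y i x - next_limit i x)).
Proof.
move=> im x01 imx; have /andP[i0 i_le] := im; have /andP[x0 x1] := x01.
have m0 : (m%:R : R) != 0 by rewrite pnatr_eq0; lia.
apply: (@derive_within_ratio _ (fun n k => Phi R m n i k)) => //.
  by move=> z /andP[z0 z1]; apply: cvg_phi; rewrite ?(ltW z0).
pose Q (nk : nat * nat) : R :=
  if i.+1 == m then nk.2%:R / nk.1%:R else Phi R m nk.1 i.+1 nk.2.
have cvg_P i' : (1 <= i' <= m)%N ->
    Phi R m nk.1 i' nk.2 @[nk --> ratio_nbhs x] --> y i' x.
  move=> im'; have := @cvg_Phi_shift 0 i' x isT im' x01.
  by under eq_fun do rewrite addn0.
have cvg_P1 : Phi R m nk.1 1 nk.2.+1 @[nk --> ratio_nbhs x] --> y 1 x.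
  have := @cvg_Phi_shift 1 1 x isT (ltnW m1) x01.
  by under eq_fun do rewrite addn1.
have xn0 : x != 0 by rewrite gt_eqF.
pose r (nk : nat * nat) : R := nk.2%:R / nk.1%:R.
(* The exact value of n (Phi^i(k+1) - Phi^i(k)), written in terms of r = k / n; the factor (r + 1 /
   n) / r is (k + 1) / k. *)
pose G (nk : nat * nat) : R :=
  (Phi R m nk.1 i nk.2 - Phi R m nk.1 1 nk.2.+1) / r nk +
  (m - i)%:R / m%:R * ((r nk + nk.1%:R^-1) / r nk *
     ((1 - r nk)^-1 * (Phi R m nk.1 i nk.2 - Q nk))).
apply: (@cvg_trans _ (G @ ratio_nbhs x)).
  apply: near_eq_cvg; near=> nk.
  have /andP[k0 kn] : (0 < nk.2 < nk.1)%N by near: nk; exact: ratio_nbhs_lt.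
  have := @Phi_rec R nk.1 m m1 i nk.2; rewrite k0 kn => /(_ isT im).
  rewrite /G /r -/(Q nk) natrD natrM (natrB _ (ltnW kn)) -natr1.
  move: kn k0; rewrite -(ltr_nat R) -(ltr0n R).
  set k := nk.2%:R; set n := nk.1%:R; set j := (m - i)%:R => kn k0.
  have n0 : 0 < n by exact: lt_trans kn.
  have k1 : 0 < k + 1 by rewrite addr_gt0.
  have nk0 : 0 < n - k by rewrite subr_gt0.
  set P := Phi R m nk.1 i nk.2; set P' := Phi R m nk.1 i nk.2.+1.
  set P1 := Phi R m nk.1 1 nk.2.+1; set q := Q nk => E.
  have -> : P' = ((j + m%:R * (n - k)) * P - j * q) * (k + 1) / (m%:R * (n - k) * k)
      - P1 / k.
    rewrite E; field.
    by rewrite m0 !gt_eqF.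
  by field; rewrite m0 !gt_eqF.
have cr : r nk @[nk --> ratio_nbhs x] --> x by exact: cvg_ratio.
apply: cvgD.
  by apply: cvgM; [apply: cvgB => //; exact: cvg_P|exact: cvgV].
(* For i = m the coefficient m - i annihilates the singular term, so x = 1 is allowed. *)
have [i_lt|m_le] := ltnP i m; last first.
  have -> : (m - i)%N = 0%N by lia.
  by rewrite !mul0r; under eq_fun do rewrite !mul0r; exact: cvg_cst.
have x_lt1 : x < 1 by rewrite i_lt in imx.
apply: cvgMr; rewrite -[X in _ --> X]mul1r.
apply: cvgM.
  rewrite -[X in _ --> X](divff xn0); apply: cvgM; last exact: cvgV.
  by rewrite -[X in _ --> X]addr0; apply: cvgD => //; exact: cvg_inv_size.
apply: cvgM.
  apply: cvgV; first by rewrite subr_eq0 gt_eqF.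
  by apply: cvgB => //; exact: cvg_cst.
apply: cvgB; first exact: cvg_P.
rewrite /Q /next_limit; case: eqP => [_|im']; first exact: cvg_ratio.
by apply: cvg_P; lia.
Unshelve. all: by end_near. Qed.

End Limit.

Theorem proposition12 (R : realType) (m : nat) (hm : (2 <= m)%N)
  (y : nat -> R -> R)
  (hunif : forall i : nat, (1 <= i <= m)%N ->
     {uniform `[0, 1]%classic, (fun n : nat => @phi R m n i) @ \oo --> y i})
  (hcont : forall i : nat, (1 <= i <= m)%N ->
     {within `]0, 1]%classic, continuous (y i)})
  (hder : forall i : nat, (1 <= i <= m)%N ->
     forall x : R, 0 < x <= 1 -> derivable_within `]0, 1]%classic (y i) x) :
  let dy (i : nat) (x : R) := derive_within `]0, 1]%classic (y i) x in
  [/\ (forall i : nat, (1 <= i <= m - 1)%N -> y i 1 = 1),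
      y m 1 = 0 &
      forall x : R, 0 < x <= 1 ->
      [/\ ((3 <= m)%N ->
            (m%:R - m%:R * x) * dy 1%N x
            = (m%:R - 1) * y 1%N x - (m%:R - 1) * y 2%N x),
          (forall i : nat, (2 <= i <= m - 2)%N ->
            (m%:R * x - m%:R * x ^+ 2) * dy i x
            = m%:R * (x - 1) * y 1%N x + (m%:R - i%:R * x) * y i x
              - x * (m%:R - i%:R) * y i.+1 x),
          (m%:R * x - m%:R * x ^+ 2) * dy (m - 1)%N x
          = - (m%:R - m%:R * x) * y 1%N x
            + (m%:R - (m%:R - 1) * x) * y (m - 1)%N x - x ^+ 2 &
          x * dy m x = - y 1%N x + y m x]].
Proof.
move=> dy.
have yE i : (1 <= i <= m)%N -> y i 1 = (i < m)%:R by exact: y1E.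
have m0 : (m%:R : R) != 0 by rewrite pnatr_eq0; lia.
have ode i (x : R) : (1 <= i < m)%N -> 0 < x <= 1 ->
    m%:R * x * (1 - x) * dy i x =
    m%:R * (1 - x) * (y i x - y 1%N x) +
    (m%:R - i%:R) * x * (y i x - next_limit m y i x).
  move=> /andP[i1 im] x01; have /andP[x0 x1] := x01.
  have im' : (1 <= i <= m)%N by rewrite i1 ltnW.
  (* At x = 1 the left side is 0 through its factor 1 - x, and the right side because y_i and the
     next term both equal 1 there. *)
  have [->|xN1] := eqVneq x 1.
    have -> : next_limit m y i 1 = 1.
      rewrite /next_limit; case: eqP => // iS.
      by rewrite yE; [have -> : (i.+1 < m)%N by lia|lia].
    by rewrite (yE i)// im /=; ring.
  rewrite /dy (derive_limit hm hunif hcont im' x01) ?im ?lt_neqAle ?xN1//.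
  by rewrite natrB 1?ltnW//; field; rewrite m0 subr_eq0 eq_sym xN1 gt_eqF.
split.
- by move=> i im; rewrite yE; [have -> : (i < m)%N by lia|lia].
- by rewrite yE; [rewrite ltnn|lia].
move=> x x01; have /andP[x0 x1] := x01; have xN0 : x != 0 by rewrite gt_eqF.
split.
(* For i = 1 the term with y_i - y_1 vanishes, and x cancels from what is left. *)
- move=> m3; apply: (mulfI xN0).
  have := ode 1%N x; rewrite /next_limit ifF; last by lia.
  move=> E; transitivity (m%:R * x * (1 - x) * dy 1%N x); first by ring.
  by rewrite E; [ring|lia|].
- move=> i im.
  have := ode i x; rewrite /next_limit ifF; last by lia.
  move=> E; transitivity (m%:R * x * (1 - x) * dy i x); first by ring.
  by rewrite E; [ring|lia|].
- have := ode (m - 1)%N x; rewrite /next_limit ifT; last by lia.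
  move=> E; transitivity (m%:R * x * (1 - x) * dy (m - 1)%N x); first by ring.
  by rewrite E; [rewrite (natrB _ (ltnW hm)); ring|lia|].
rewrite /dy (derive_limit hm hunif hcont _ x01) ?ltnn ?leqnn ?andbT//; last by lia.
by rewrite subnn !mul0r addr0; field.
Qed.
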